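(* Let $r_0,\dots,r_{m_{\mathsf p}}$ be the positive roots, $A_{m_{\mathsf p}}$ the matrix and $\mathcal{R}^{m_{\mathsf p}}$ the constant defined in the context, and put $$b^\star=c+\sum_{i=1}^{m_{\mathsf p}+1}\frac1{r_{i-1}}-\sum_{i=2}^{m_{\mathsf p}+1}\frac1{\beta^{\mathsf p}_{i-1}},\qquad K_{j-1}=\frac{\mathcal{R}^{m_{\mathsf p}}\,\mathrm{Cof}_{1,j}[A_{m_{\mathsf p}}]}{r_{j-1}^2\det[A_{m_{\mathsf p}}]},\quad j\in\{1,\dots,m_{\mathsf p}+1\}.$$ Then $b^\star>c$, $K_{j-1}>0$ for every $j\in\{1,\dots,m_{\mathsf p}+1\}$, and the function $v_{b^\star}$ given by $$v_{b^\star}(x,y)=\begin{cases}\displaystyle\sum_{j=1}^{m_{\mathsf p}+1}\frac{K_{j-1}}{\alpha r_{j-1}}\big[1-e^{-\alpha r_{j-1}y}\big]e^{r_{j-1}(x-b^\star)} & \text{if } x<b^\star,\ y\ge0,\\[2mm] \displaystyle\sum_{j=1}^{m_{\mathsf p}+1}\frac{K_{j-1}}{\alpha r_{j-1}}\big[1-e^{-\alpha r_{j-1}[y-(x-b^\star)/\alpha]}\big]+\frac{(x-c)^2-(b^\star-c)^2}{2\alpha} & \text{if } b^\star\le x<\alpha y+b^\star,\ y>0,\\[2mm] (x-c)y-\frac\alpha2y^2 & \text{if } x\ge\alpha y+b^\star,\ y\ge0,\end{cases}$$ is a solution to the following system: (i) $v_{b^\star}(x,y)=(x-c)y-\alpha\frac{y^2}{2}$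 for $x\ge\alpha y+b^\star$, $y\ge0$; (ii) $v_{b^\star}(x,y)=\dfrac{(x-c)^2-(c-b^\star)^2}{2\alpha}+v_{b^\star}\Big(b^\star,\,y-\dfrac{x-b^\star}{\alpha}\Big)$ for $b^\star\le x<\alpha y+b^\star$, $y>0$; (iii) $\mathcal{D}v_{b^\star}(x,y)=0$ for $x<b^\star$, $y\ge0$.
   Context: **Parameters.** $\mu\in\mathbb{R}$, $\sigma>0$, $\alpha>0$, $\rho>0$, $c>0$, $\lambda_{\mathsf n},\lambda_{\mathsf p}>0$. For $u\in\{\mathsf n,\mathsf p\}$: $m_u$ is a positive integer, $0<\beta^u_1<\dots<\beta^u_{m_u}$, $\omega^u_k>0$ with $\sum_{k=1}^{m_u}\omega^u_k=1$, and $P_u$ is the hyper-exponential law on $(0,\infty)$ with density $\sum_{k=1}^{m_u}\omega^u_k\beta^u_k e^{-\beta^u_k z}$. **Operator.** $$\mathcal{D}f(x,y)=\frac{\sigma^2}{2}f_{xx}+\mu f_x-(\rho+\lambda_{\mathsf n}+\lambda_{\mathsf p})f+\lambda_{\mathsf n}\int_0^\infty f(x-z,y)\,dP_{\mathsf n}(z)+\lambda_{\mathsf p}\int_0^\infty f(x+z,y)\,dP_{\mathsf p}(z).$$ **Roots.** The equation $$\frac{\sigma^2r^2}{2}+\mu r-(\rho+\lambda_{\mathsf n}+\lambda_{\mathsf p})+\lambda_{\mathsf p}\sum_{i=1}^{m_{\mathsf p}}\frac{\omega^{\mathsf p}_i\beta^{\mathsf p}_i}{\beta^{\mathsf p}_i-r}+\lambda_{\mathsf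 n}\sum_{i=1}^{m_{\mathsf n}}\frac{\omega^{\mathsf n}_i\beta^{\mathsf n}_i}{\beta^{\mathsf n}_i+r}=0$$ has $m_{\mathsf p}+1$ positive roots $r_0,\dots,r_{m_{\mathsf p}}$, with $0<r_0<\beta^{\mathsf p}_1<r_1<\beta^{\mathsf p}_2<\dots<\beta^{\mathsf p}_{m_{\mathsf p}}<r_{m_{\mathsf p}}$ (known fact). **Matrix and constant.** $A_{m_{\mathsf p}}$ is the $(m_{\mathsf p}+1)\times(m_{\mathsf p}+1)$ matrix whose first row has all entries $1$ and whose $(i+1,j)$ entry is $\beta^{\mathsf p}_i/(\beta^{\mathsf p}_i-r_{j-1})$ for $1\le i\le m_{\mathsf p}$, $1\le j\le m_{\mathsf p}+1$; $\mathrm{Cof}_{i,j}[\cdot]$ denotes the $(i,j)$ cofactor. $\mathcal{R}^{m_{\mathsf p}}=\prod_{k=1}^{m_{\mathsf p}+1}r_{k-1}\big/\prod_{k=2}^{m_{\mathsf p}+1}\beta^{\mathsf p}_{k-1}$. *)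

(* Defs.v *)
From HB Require Import structures.
From mathcomp Require Import all_boot all_order all_algebra.
From mathcomp Require Import all_classical all_reals all_analysis.

Set Implicit Arguments.
Unset Strict Implicit.
Unset Printing Implicit Defensive.

Import Order.TTheory GRing.Theory Num.Theory.
Import numFieldNormedType.Exports.

Local Open Scope classical_set_scope.
Local Open Scope ring_scope.

(* Indices are 0-based: beta_k is [beta i] with i : 'I_m and i = k - 1,
   while r_0, ..., r_m is [r : 'I_m.+1 -> R]. *)

Definition hyperexp_params (R : realType) (m : nat) (omega beta : 'I_m -> R)
    : Prop :=
  [/\ (0 < m)%N,
      forall i, 0 < beta i,
      forall i j : 'I_m, (i < j)%N -> beta i < beta j,
      forall i, 0 < omega i
    & \sum_(i < m) omega i = 1].

Definition hyperexp_pdf (R : realType) (m : nat) (omega beta : 'I_m -> R)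
    : R -> R :=
  (fun z => \sum_(i < m) omega i * beta i * expR (- beta i * z)) \_ `]0, +oo[.

Definition hyperexp_law (R : realType) (m : nat) (omega beta : 'I_m -> R)
    (P : probability (measurableTypeR R) R) : Prop :=
  forall B : set (measurableTypeR R), measurable B ->
    P B = (\int[lebesgue_measure]_(z in B) (hyperexp_pdf omega beta z)%:E)%E.

Definition opD (R : realType) (mu sigma rho lamn lamp : R)
    (Pn Pp : probability (measurableTypeR R) R) (f : R -> R -> R) (x y : R)
    : R :=
  sigma ^+ 2 / 2 * derive1n 2 (f ^~ y) x + mu * derive1 (f ^~ y) x
  - (rho + lamn + lamp) * f x y
  + lamn * (\int[Pn]_(z in `]0, +oo[) f (x - z) y)
  + lamp * (\int[Pp]_(z in `]0, +oo[) f (x + z) y).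

(* [derive1] and [Rintegral] are total, with junk values where the derivative
   or the integral does not exist; [opD_defined] says that every term of
   [opD ... f x y] is a genuine derivative or integral. *)
Definition opD_defined (R : realType)
    (Pn Pp : probability (measurableTypeR R) R) (f : R -> R -> R) (x y : R)
    : Prop :=
  [/\ \forall t \near x, derivable (f ^~ y : R -> R) t 1,
      derivable (derive1 (f ^~ y) : R -> R) x 1,
      Pn.-integrable `]0, +oo[ (fun z => (f (x - z) y)%:E)
    & Pp.-integrable `]0, +oo[ (fun z => (f (x + z) y)%:E)].

Definition char_fun (R : realType) (mu sigma rho lamn lamp : R) (mn mp : nat)
    (omegan betan : 'I_mn -> R) (omegap betap : 'I_mp -> R) (s : R) : R :=
  sigma ^+ 2 * s ^+ 2 / 2 + mu * s - (rho + lamn + lamp)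
  + lamp * (\sum_(i < mp) omegap i * betap i / (betap i - s))
  + lamn * (\sum_(i < mn) omegan i * betan i / (betan i + s)).

Definition interlacing (R : realType) (m : nat) (beta : 'I_m -> R)
    (r : 'I_m.+1 -> R) : Prop :=
  0 < r ord0 /\
  forall i : 'I_m, r (widen_ord (leqnSn m) i) < beta i < r (lift ord0 i).

(* [unlift ord0 i] is [None] on the first row and [Some k] on row k.+1. *)
Definition matA (R : realType) (m : nat) (beta : 'I_m -> R) (r : 'I_m.+1 -> R)
    : 'M[R]_m.+1 :=
  \matrix_(i < m.+1, j < m.+1)
    if unlift ord0 i is Some k then beta k / (beta k - r j) else 1.

Definition constR (R : realType) (m : nat) (beta : 'I_m -> R)
    (r : 'I_m.+1 -> R) : R :=
  (\prod_(j < m.+1) r j) / (\prod_(i < m) beta i).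

Definition bstar (R : realType) (c : R) (m : nat) (beta : 'I_m -> R)
    (r : 'I_m.+1 -> R) : R :=
  c + \sum_(j < m.+1) 1 / r j - \sum_(i < m) 1 / beta i.

Definition constK (R : realType) (m : nat) (beta : 'I_m -> R)
    (r : 'I_m.+1 -> R) (j : 'I_m.+1) : R :=
  constR beta r * cofactor (matA beta r) ord0 j
  / (r j ^+ 2 * \det (matA beta r)).

(* Only the values at y >= 0 are meaningful; there, the last branch is reached
   exactly when x >= alpha * y + b. *)
Definition vfun (R : realType) (alpha c b : R) (m : nat) (K r : 'I_m.+1 -> R)
    (x y : R) : R :=
  if x < b then
    \sum_(j < m.+1) K j / (alpha * r j) * (1 - expR (- alpha * r j * y))
                    * expR (r j * (x - b))
  else if x < alpha * y + b then
    \sum_(j < m.+1) K j / (alpha * r j)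
                    * (1 - expR (- alpha * r j * (y - (x - b) / alpha)))
    + ((x - c) ^+ 2 - (b - c) ^+ 2) / (2 * alpha)
  else (x - c) * y - alpha / 2 * y ^+ 2.

(* Main.v *)
(** Put [L_j = Cof_{1,j}(A) / det A], so that [A L] is the first unit vector.
    This says that [sum_j L_j / (X - r_j)] is the partial fraction expansion of
    [prod_i (X - beta_i) / prod_j (X - r_j)].  Evaluating at [r_j] and using
    the interlacing gives [L_j > 0], hence [K_j > 0]; the value and the
    derivative at [0] give [sum_j K_j r_j = 1] and [sum_j K_j = b - c], hence
    [b > c]; the remaining rows of [A L] give
    [sum_j K_j r_j ^ 2 / (beta_i - r_j) = 0].

    On each of its three regions [v(., y)] is a polynomial of degree at most 2
    plus a combination of exponentials, so [v(x + z, y) beta e ^ (- beta z)] has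
    an explicit antiderivative in [z].  The three relations on [K] make these
    antiderivatives agree at the two interfaces, so that the boundary terms
    cancel and the upward jumps act on [e ^ (r_j x)] as if this exponential
    extended beyond [b], with multiplier [beta / (beta - r_j)]; then
    [D v = sum_j D_j char_fun(r_j) = 0]. *)

Require Import Defs.
From HB Require Import structures.
From mathcomp Require Import all_boot all_order all_algebra.
From mathcomp Require Import all_classical all_reals all_analysis.
From mathcomp Require Import measurable_realfun.
From mathcomp Require Import ring lra.

Set Implicit Arguments.
Unset Strict Implicit.
Unset Printing Implicit Defensive.

Import Order.TTheory GRing.Theory Num.Theory.
Import numFieldNormedType.Exports.

Local Open Scope classical_set_scope.
Local Open Scope ring_scope.

(** * Partial fractions over interlacing nodes *)

(** Logarithmic derivative of a product of linear factors; at [x = 0] it produces the sums of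
    inverses that occur in [bstar]. *)
Lemma horner_deriv_prod_XsubC (F : fieldType) (I : finType) (P : pred I)
    (a : I -> F) (x : F) : (forall i, P i -> x != a i) ->
  (\prod_(i | P i) ('X - (a i)%:P))^`().[x] =
  (\prod_(i | P i) (x - a i)) * \sum_(i | P i) (x - a i)^-1.
Proof.
move=> xa.
(* The product rule involves the value of the partial product, so the induction carries derivative
   and value together. *)
pose Q (q : {poly F}) (s t : F) := q^`().[x] = s * t /\ q.[x] = s.
suff [] : Q (\prod_(i | P i) ('X - (a i)%:P)) (\prod_(i | P i) (x - a i))
            (\sum_(i | P i) (x - a i)^-1) by [].
apply: (big_rec3 Q) => [|i q s t Pi [dq qE]].
  by split; rewrite ?derivC ?hornerC ?mulr0.
have xai : x - a i != 0 by rewrite subr_eq0 xa.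
split; last by rewrite hornerM hornerXsubC qE.
by rewrite derivM derivXsubC mul1r hornerD hornerM hornerXsubC dq qE; field.
Qed.

(** * Numerators of sums of simple fractions *)

Section lagrange.
Variables (F : fieldType) (m : nat) (r u : 'I_m.+1 -> F).

(** Numerator of [sum_j u_j / (X - r_j)] over the common denominator [prod_j (X - r_j)]; being a
    polynomial, it can be evaluated at the nodes too. *)
Definition node_comb : {poly F} :=
  \sum_j u j *: \prod_(k | k != j) ('X - (r k)%:P).

Lemma size_node_prod j : size (\prod_(k | k != j) ('X - (r k)%:P)) = m.+1.
Proof.
rewrite -big_filter size_prod_XsubC size_filter.
by have := cardC1 j; rewrite card_ord -sum1_card -sum1_count => ->.
Qed.

Lemma size_node_comb : (size node_comb <= m.+1)%N.
Proof.
apply: (leq_trans (size_sum _ _ _)); apply/bigmax_leqP => j _.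
by rewrite (leq_trans (size_scale_leq _ _))// size_node_prod.
Qed.

Lemma coef_node_comb : node_comb`_m = \sum_j u j.
Proof.
rewrite coef_sum; apply: eq_bigr => j _; rewrite coefZ.
have /monicP := monic_prod_XsubC (index_enum 'I_m.+1) (fun k => k != j) r.
by rewrite /lead_coef size_node_prod => ->; rewrite mulr1.
Qed.

Lemma horner_node_comb x : (forall j, x != r j) ->
  node_comb.[x] = (\prod_j (x - r j)) * \sum_j u j / (x - r j).
Proof.
move=> xr; rewrite horner_sum mulr_sumr; apply: eq_bigr => j _.
rewrite hornerZ horner_prod [in RHS](bigD1 j)//=.
under eq_bigr do rewrite hornerXsubC.
have : x - r j != 0 by rewrite subr_eq0.
by move=> ?; field.
Qed.

Lemma horner_node_comb_node j :
  node_comb.[r j] = u j * \prod_(k | k != j) (r j - r k).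
Proof.
rewrite horner_sum (bigD1 j)//= [X in _ + X]big1 ?addr0 => [|k kj].
  by rewrite hornerZ horner_prod; under eq_bigr do rewrite hornerXsubC.
rewrite hornerZ horner_prod (bigD1 j) 1?eq_sym//= hornerXsubC subrr.
by rewrite mul0r mulr0.
Qed.

(** In the [j]-th term the factor [X - r j] is missing, so [1 / (x - r j)] is subtracted from the
    sum of inverses; this produces the second-order sum. *)
Lemma horner_deriv_node_comb x : (forall j, x != r j) ->
  (node_comb^`()).[x] = (\prod_j (x - r j)) *
    ((\sum_j u j / (x - r j)) * (\sum_j (x - r j)^-1)
     - \sum_j u j / (x - r j) ^+ 2).
Proof.
move=> xr; rewrite (raddf_sum (@deriv F)) horner_sum mulr_suml -sumrB mulr_sumr.
apply: eq_bigr => j _; rewrite /= derivZ hornerZ horner_deriv_prod_XsubC//.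
have := xr j; rewrite -subr_eq0 => xj.
rewrite [in RHS](bigD1 j)//= [X in _ / _ * X](bigD1 j)//=.
by field.
Qed.

End lagrange.

(** * Consequences of the interlacing *)

Section interlaced.
Variables (R : realType) (m : nat) (beta : 'I_m -> R) (r : 'I_m.+1 -> R).
Hypothesis hr : interlacing beta r.

(** The hypothesis compares neighbours only, [r_i < beta_i < r_{i+1}] with 0-based indices;
    induction on [j] climbs this chain. *)
Lemma interlacing_gt (j : 'I_m.+1) (i : 'I_m) :
  (i < j)%N -> beta i < r j.
Proof.
case: hr => _ hb; case: j => j jm /=.
elim: j jm => // j IH jm.
rewrite ltnS leq_eqVlt => /predU1P[ij|ij].
  have /andP[_ h] := hb i.
  by rewrite (_ : Ordinal jm = lift ord0 i)//; apply/val_inj; rewrite /= ij.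
have jm' : (j < m)%N by [].
have /andP[h1 h2] := hb (Ordinal jm').
have h := IH (ltnW jm) ij.
rewrite (_ : Ordinal jm = lift ord0 (Ordinal jm')); last exact/val_inj.
apply: lt_trans h2; apply: lt_trans h1.
by rewrite (_ : widen_ord _ _ = Ordinal (ltnW jm))//; exact/val_inj.
Qed.

Lemma interlacing_lt (j : 'I_m.+1) (i : 'I_m) :
  (j <= i)%N -> r j < beta i.
Proof.
have [_ hb] := hr; rewrite leq_eqVlt => /predU1P[ji|ji].
  by have /andP[+ _] := hb i; rewrite (_ : widen_ord _ _ = j)//; exact/val_inj.
have jm : (j < m)%N by exact: ltn_trans (ltn_ord i).
have /andP[h _] := hb (Ordinal jm).
have /andP[h' _] := hb i.
rewrite (_ : widen_ord _ _ = j) in h; last exact/val_inj.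
apply: (lt_trans h); apply: lt_trans h'.
exact: interlacing_gt.
Qed.

Lemma interlacing_mono : {mono r : j k / (j <= k)%O >-> j <= k}.
Proof.
apply: le_mono => j k; rewrite ltEord => jk.
have jm : (j < m)%N by rewrite (leq_trans jk)// -ltnS.
by apply: (@lt_trans _ _ (beta (Ordinal jm)));
  [exact: interlacing_lt|exact: interlacing_gt].
Qed.

Lemma interlacing_inj : injective r.
Proof. exact/inc_inj/interlacing_mono. Qed.

Lemma interlacing_root_gt0 j : 0 < r j.
Proof.
have [r0 _] := hr; apply: (lt_le_trans r0).
by rewrite interlacing_mono leEord.
Qed.

Lemma interlacing_neq i j : beta i != r j.
Proof.
by have [ij|ji] := ltnP i j; rewrite ?(gt_eqF (interlacing_lt ji))//
  (lt_eqF (interlacing_gt ij)).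
Qed.

Lemma interlacing_beta_gt0 i : 0 < beta i.
Proof.
apply: lt_trans (interlacing_root_gt0 ord0) _; exact: interlacing_lt.
Qed.

Lemma interlacing_beta_inj : injective beta.
Proof.
have H (i i' : 'I_m) : (i < i')%N -> beta i != beta i'.
  move=> ii'; rewrite lt_eqF//; have /andP[h _] := hr.2 i'.
  by apply: lt_trans h; exact: interlacing_gt.
move=> i i' /eqP e; apply/val_inj/eqP; move: e.
by apply: contraLR; rewrite neq_ltn => /orP[/H//|/H]; rewrite eq_sym.
Qed.

(* The partial fraction decomposition
   [sum_j u_j / (X - r_j) = prod_i (X - beta_i) / prod_j (X - r_j)]. *)
Lemma node_comb_interlacing (u : 'I_m.+1 -> R) :
  (forall i, \sum_j u j / (beta i - r j) = 0) ->
  node_comb r u = (\sum_j u j) *: \prod_i ('X - (beta i)%:P).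
Proof.
move=> hu; apply/eqP; rewrite -subr_eq0; apply/eqP.
set p := _ - _.
have Pm := monic_prod_XsubC (index_enum 'I_m) predT beta.
have Psz : size (\prod_i ('X - (beta i)%:P)) = m.+1.
  by rewrite size_prod_XsubC /index_enum -enumT size_enum_ord.
(* All the products are monic, so the coefficients of degree [m] cancel; what remains has degree
   below [m], yet vanishes at the [m] points [beta i]. *)
have psz : (size p <= m)%N.
  apply/leq_sizeP => k; rewrite leq_eqVlt => /predU1P[<-|mk].
    rewrite coefB coef_node_comb coefZ.
    by move/monicP: Pm; rewrite /lead_coef Psz => ->; rewrite mulr1 subrr.
  rewrite nth_default// (leq_trans _ mk)// (leq_trans (size_polyD _ _))//.
  rewrite geq_max size_node_comb/= size_polyN.
  by rewrite (leq_trans (size_scale_leq _ _))// Psz.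
apply: (@roots_geq_poly_eq0 _ _ [seq beta i | i <- enum 'I_m]).
- apply/allP => _ /mapP[i _ ->]; rewrite /root /p hornerD hornerN hornerZ.
  rewrite horner_node_comb; last by move=> j; exact: interlacing_neq.
  by rewrite hu mulr0 horner_prod (bigD1 i)//= hornerXsubC subrr mul0r mulr0 subrr.
- by rewrite map_inj_uniq ?enum_uniq//; exact: interlacing_beta_inj.
- by rewrite size_map size_enum_ord.
Qed.

(** * The linear system and its residues *)

Lemma matA_col (u : 'I_m.+1 -> R) i :
  (matA beta r *m \col_j u j) i ord0 =
  if unlift ord0 i is Some k then beta k * \sum_j u j / (beta k - r j)
  else \sum_j u j.
Proof.
rewrite !mxE; case: unliftP => [k ->|->]; rewrite ?mulr_sumr; apply: eq_bigr => j _;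
  by rewrite !mxE ?liftK ?unlift_none ?mul1r// mulrAC -mulrA.
Qed.

(** A kernel vector [u] satisfies every pole condition and [sum_j u_j = 0], so its numerator is the
    zero polynomial; evaluation at the distinct nodes forces [u = 0]. *)
Lemma det_matA_neq0 : \det (matA beta r) != 0.
Proof.
rewrite -det_tr; apply/det0P => -[v v0 vA].
pose u j := v ord0 j.
have Au i : (matA beta r *m \col_j u j) i ord0 = 0.
  have -> : \col_j u j = v^T by apply/matrixP => k l; rewrite !mxE (ord1 l).
  by rewrite -[_ *m _]trmxK trmx_mul trmxK vA !mxE.
have u0 : \sum_j u j = 0.
  by have := Au ord0; rewrite matA_col unlift_none.
have ui i : \sum_j u j / (beta i - r j) = 0.
  have := Au (lift ord0 i); rewrite matA_col liftK => /eqP.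
  by rewrite mulf_eq0 gt_eqF ?interlacing_beta_gt0//= => /eqP.
have uE j : u j = 0.
  have /eqP := horner_node_comb_node r u j.
  rewrite node_comb_interlacing// u0 scale0r hornerC eq_sym mulf_eq0.
  case/orP => [/eqP//|]; rewrite prodf_seq_eq0 => /hasP[k _ /andP[kj]].
  rewrite subr_eq0 => /eqP /interlacing_inj jk.
  by rewrite jk eqxx in kj.
by move/eqP: v0; apply; apply/rowP => j; rewrite mxE; exact: uE.
Qed.

(** First column of the inverse of [matA beta r] by Cramer's rule; it is also the residue at [r j]
    of [prod_i (X - beta_i) / prod_k (X - r_k)]. *)
Definition resid j : R := cofactor (matA beta r) ord0 j / \det (matA beta r).

Lemma matA_resid : matA beta r *m \col_j resid j = \col_i (i == ord0)%:R.
Proof.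
have -> : \col_j resid j = (\det (matA beta r))^-1 *: col ord0 (\adj (matA beta r)).
  by apply/matrixP => j k; rewrite !mxE mulrC.
rewrite -scalemxAr colE mulmxA mul_mx_adj -colE; apply/matrixP => i k.
rewrite !mxE; case: eqP => _; last by rewrite mulr0n mulr0.
by rewrite mulr1n mulVf ?det_matA_neq0.
Qed.

Lemma sum_resid : \sum_j resid j = 1.
Proof.
have /matrixP/(_ ord0 ord0) := matA_resid.
by rewrite matA_col unlift_none mxE eqxx.
Qed.

Lemma sum_resid_pole i : \sum_j resid j / (beta i - r j) = 0.
Proof.
have /matrixP/(_ (lift ord0 i) ord0) := matA_resid.
rewrite matA_col liftK mxE eq_sym (negPf (neq_lift _ _))/= => /eqP.
by rewrite mulf_eq0 gt_eqF ?interlacing_beta_gt0//= => /eqP.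
Qed.

Lemma node_comb_resid : node_comb r resid = \prod_i ('X - (beta i)%:P).
Proof.
by rewrite node_comb_interlacing ?sum_resid ?scale1r//; exact: sum_resid_pole.
Qed.

(** Evaluating the numerator at [r j] gives [resid j = prod_i (r_j - beta_i) / prod_{k != j} (r_j -
    r_k)]. Pairing [beta i] with [r (lift j i)] makes each quotient positive, since both lie on the
    same side of [r j]. *)
Lemma resid_gt0 j : 0 < resid j.
Proof.
have rj k : r j - r (lift j k) != 0.
  by rewrite subr_eq0; apply/eqP => /interlacing_inj; apply/eqP; rewrite neq_lift.
have prod_lift : \prod_(k | k != j) (r j - r k) = \prod_k (r j - r (lift j k)).
  rewrite big_mkcond (bigD1_ord j)//= eqxx mul1r; apply: eq_bigr => k _.
  by rewrite eq_sym neq_lift.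
have := horner_node_comb_node r resid j.
rewrite node_comb_resid horner_prod prod_lift => /esym.
move=> /(canRL (mulfK _)) ->; last first.
  by apply/prodf_neq0 => k _.
rewrite -prodf_div prodr_gt0// => i _; rewrite hornerXsubC.
have [ij|ji] := ltnP i j.
  have h : (lift j i < j)%O by rewrite ltEord /= /bump (leqNgt j i) ij.
  rewrite divr_gt0// subr_gt0; first exact: interlacing_gt.
  by rewrite (leW_mono interlacing_mono).
have h : (j < lift j i)%O by rewrite ltEord /= /bump ji ltnS.
rewrite nmulr_rgt0 ?invr_lt0 subr_lt0; last exact: interlacing_lt.
by rewrite (leW_mono interlacing_mono).
Qed.

Let root_sub_neq0 j : 0 - r j != 0 :> R.
Proof. by rewrite sub0r oppr_eq0 gt_eqF// interlacing_root_gt0. Qed.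

Let beta_sub_neq0 i : 0 - beta i != 0 :> R.
Proof. by rewrite sub0r oppr_eq0 gt_eqF// interlacing_beta_gt0. Qed.

Let prod_opp_r : \prod_j (0 - r j) = - ((-1) ^+ m * \prod_j r j).
Proof.
under eq_bigr do rewrite sub0r.
by rewrite prodrN card_ord exprS mulN1r mulNr.
Qed.

Let prod_opp_beta : \prod_i (0 - beta i) = (-1) ^+ m * \prod_i beta i.
Proof. by under eq_bigr do rewrite sub0r; rewrite prodrN card_ord. Qed.

Let prod_r_gt0 : 0 < \prod_j r j.
Proof. by apply: prodr_gt0 => j _; exact: interlacing_root_gt0. Qed.

Let prod_beta_gt0 : 0 < \prod_i beta i.
Proof. by apply: prodr_gt0 => j _; exact: interlacing_beta_gt0. Qed.

Lemma constR_gt0 : 0 < constR beta r.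
Proof. exact: divr_gt0. Qed.

(** The two forms of the numerator are compared at [0], where the powers of [-1] cancel. *)
Lemma sum_resid_div : \sum_j resid j / r j = (constR beta r)^-1.
Proof.
have zr j : 0 != r j by rewrite -subr_eq0.
have := horner_node_comb resid zr.
rewrite node_comb_resid horner_prod; under eq_bigr do rewrite hornerXsubC.
have -> : \sum_j resid j / (0 - r j) = - \sum_j resid j / r j.
  by rewrite -sumrN; apply: eq_bigr => j _; rewrite sub0r invrN mulrN.
rewrite prod_opp_beta prod_opp_r mulrNN -mulrA => /eqP.
rewrite (inj_eq (mulfI _)) ?expf_neq0 ?oppr_eq0 ?oner_eq0// => /eqP h.
by rewrite /constR invf_div h mulrC mulKf ?gt_eqF.
Qed.

(** The same comparison for derivatives at [0]: the product form brings the inverses of [beta], the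
    node form those of [r]. *)
Lemma sum_resid_div2 : \sum_j resid j / r j ^+ 2 =
  (constR beta r)^-1 * (\sum_j (r j)^-1 - \sum_i (beta i)^-1).
Proof.
have zr j : 0 != r j by rewrite -subr_eq0.
have zb i : 0 != beta i by rewrite -subr_eq0.
have := horner_deriv_node_comb resid zr.
rewrite node_comb_resid horner_deriv_prod_XsubC//.
have -> : \sum_j resid j / (0 - r j) ^+ 2 = \sum_j resid j / r j ^+ 2.
  by apply: eq_bigr => j _; rewrite sub0r sqrrN.
have -> : \sum_j resid j / (0 - r j) = - (constR beta r)^-1.
  by rewrite -sum_resid_div -sumrN; apply: eq_bigr => j _; rewrite sub0r invrN mulrN.
have -> : \sum_j (0 - r j)^-1 = - \sum_j (r j)^-1.
  by rewrite -sumrN; apply: eq_bigr => j _; rewrite sub0r invrN.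
have -> : \sum_j (0 - beta j)^-1 = - \sum_j (beta j)^-1.
  by rewrite -sumrN; apply: eq_bigr => j _; rewrite sub0r invrN.
rewrite prod_opp_beta prod_opp_r mulNr -mulrA => /eqP.
rewrite -mulrN -mulrA (inj_eq (mulfI _)) ?expf_neq0 ?oppr_eq0 ?oner_eq0// => /eqP.
rewrite /constR; set p := \prod_j r j; set q := \prod_j beta j.
have p0 : p != 0 by rewrite gt_eqF.
have q0 : q != 0 by rewrite gt_eqF.
move=> h; apply: (mulfI p0); rewrite !invf_div.
set X := \sum_j resid j / r j ^+ 2 in h *.
suff -> : p * X = q * (\sum_j (r j)^-1) - q * (\sum_j (beta j)^-1) by field.
move: h; rewrite invf_div => h.
suff : q * (- \sum_j (beta j)^-1) = - (q * (\sum_j (r j)^-1)) + p * X by lra.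
by rewrite h; field.
Qed.

Lemma constKE j : constK beta r j = constR beta r * resid j / r j ^+ 2.
Proof.
have /negbT rj := gt_eqF (interlacing_root_gt0 j).
have := det_matA_neq0; rewrite /constK /resid => ?; field.
by rewrite rj.
Qed.

Lemma constK_gt0 j : 0 < constK beta r j.
Proof.
rewrite constKE; apply: divr_gt0.
  by apply: mulr_gt0; [exact: constR_gt0|exact: resid_gt0].
by apply: exprn_gt0; exact: interlacing_root_gt0.
Qed.

(** The factor [constR] in [constK] cancels the one in [sum_resid_div2]. This identity ties the
    threshold to the coefficients, and positivity of the latter then yields [c < b]. *)
Lemma sum_constK c : \sum_j constK beta r j = bstar c beta r - c.
Proof.
under eq_bigr do rewrite constKE -mulrA.
rewrite -mulr_sumr sum_resid_div2 mulVKf ?gt_eqF ?constR_gt0//.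
have inv1 n (f : 'I_n -> R) : \sum_i 1 / f i = \sum_i (f i)^-1.
  by apply: eq_bigr => i _; rewrite div1r.
by rewrite /bstar !inv1; ring.
Qed.

Lemma sum_constK_root : \sum_j constK beta r j * r j = 1.
Proof.
transitivity (constR beta r * \sum_j resid j / r j).
  rewrite mulr_sumr; apply: eq_bigr => j _; rewrite constKE.
  by have := gt_eqF (interlacing_root_gt0 j) => /negbT ?; field.
by rewrite sum_resid_div mulfV// gt_eqF ?constR_gt0.
Qed.

Lemma sum_constK_pole i :
  \sum_j constK beta r j * r j ^+ 2 / (beta i - r j) = 0.
Proof.
transitivity (constR beta r * \sum_j resid j / (beta i - r j)); last first.
  by rewrite sum_resid_pole mulr0.
rewrite mulr_sumr; apply: eq_bigr => j _; rewrite constKE mulrA; congr (_ / _).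
by rewrite divfK// expf_neq0// gt_eqF// interlacing_root_gt0.
Qed.

End interlaced.

(** * Polynomials times exponentials *)

Section exp_poly.
Variable R : realType.

(** This family is closed under differentiation; it contains the three pieces of the value function
    ([s = 0]) and their products with an exponential weight ([s = - beta]). *)
Definition exp_poly (p : {poly R}) (s : R) n (k t : 'I_n -> R) (z : R) : R :=
  p.[z] * expR (s * z) + \sum_i k i * expR (t i * z).

Lemma is_derive_expRM (s z : R) :
  is_derive z 1 (fun z => expR (s * z)) (s * expR (s * z)).
Proof.
have h : is_derive z 1 (fun z => s * z) s.
  by apply: is_derive_eq; rewrite scaler1.
have := @is_derive1_comp _ expR (fun z => s * z) z _ _ (is_derive_expR _) h.
by rewrite mulrC.
Qed.

Lemma measurable_expRM (s : R) : measurable_fun setT (fun z => expR (s * z)).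
Proof.
apply: continuous_measurable_fun => z; apply: differentiable_continuous.
by apply/derivable1_diffP; have [] := is_derive_expRM s z.
Qed.

Lemma is_derive_exp_poly (p : {poly R}) (s : R) n (k t : 'I_n -> R) (z : R) :
  is_derive z 1 (exp_poly p s k t)
    (exp_poly (p^`() + s *: p) s (fun i => k i * t i) t z).
Proof.
have dp := is_derive_poly p z.
have de := is_derive_expRM s z.
have dt i : is_derive z 1 (k i \*: fun z => expR (t i * z))
    (k i *: (t i * expR (t i * z))).
  have := is_derive_expRM (t i) z => ?; exact: is_deriveZ.
have -> : exp_poly p s k t = horner p * (fun z => expR (s * z))
    + \sum_i (k i \*: fun z => expR (t i * z)).
  by apply/funext => x; rewrite /exp_poly fctE /= fct_sumE.
apply: is_derive_eq.
rewrite /exp_poly !hornerE; congr (_ + _); last first.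
  by apply: eq_bigr => i _; rewrite -[_ *: _]/(_ * _) mulrA.
by rewrite -![_ *: _]/(_ * _); ring.
Qed.

Lemma continuous_exp_poly (p : {poly R}) (s : R) n (k t : 'I_n -> R) :
  continuous (exp_poly p s k t).
Proof.
move=> z; apply: differentiable_continuous; apply/derivable1_diffP.
by have [] := is_derive_exp_poly p s k t z.
Qed.

Lemma measurable_exp_poly (p : {poly R}) (s : R) n (k t : 'I_n -> R) :
  measurable_fun setT (exp_poly p s k t).
Proof. by apply: continuous_measurable_fun; exact: continuous_exp_poly. Qed.

Lemma cvgr_expRM (s : R) : s < 0 -> expR (s * z) @[z --> +oo] --> 0.
Proof.
move=> s0.
have -> : (fun z => expR (s * z)) = (fun z => expR (- z)) \o (fun z => - s * z).
  by apply/funext => z /=; congr expR; ring.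
apply: (@cvg_comp _ _ _ _ _ _ (pinfty_nbhs R)); last exact: cvgr_expR.
by apply: gt0_cvgMry => //; rewrite oppr_gt0.
Qed.

(** The bound [e^u >= 1 + u^(j+1) / (j+1)!] at [u = - s z] uses one power more than [z^j], which
    leaves a majorant [C / z]. *)
Lemma cvgr_expn_expRM (s : R) j : s < 0 -> z ^+ j * expR (s * z) @[z --> +oo] --> 0.
Proof.
move=> s0; pose C := j.+1`!%:R / (- s) ^+ j.+1.
apply: (@squeeze_cvgr _ _ _ _ (fun=> 0) (fun z => C * z^-1)).
- near=> z.
  have z0 : 0 < z by near: z; exact: nbhs_pinfty_gt.
  rewrite mulr_ge0 ?exprn_ge0 ?expR_ge0 ?(ltW z0)//=.
  have sz : 0 <= - s * z by rewrite mulr_ge0 ?oppr_ge0 ?ltW.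
  have := expR_ge1Dxn j sz.
  rewrite exprMn => h.
  have Hp : 0 < (- s) ^+ j.+1 * z ^+ j.+1 / j.+1`!%:R.
    by rewrite divr_gt0 ?mulr_gt0 ?exprn_gt0 ?oppr_gt0 ?ltr0n ?fact_gt0.
  have {}h := le_trans (ler_wpDl ler01 (lexx _)) h.
  rewrite -[s]opprK mulNr expRN.
  rewrite -ler_pdivlMl ?exprn_gt0//.
  apply: (@le_trans _ _ ((- s) ^+ j.+1 * z ^+ j.+1 / j.+1`!%:R)^-1).
    by rewrite lef_pV2 ?posrE ?expR_gt0//.
  have f0 : j.+1`!%:R != 0 :> R by rewrite pnatr_eq0 -lt0n fact_gt0.
  have u0 : (- s) ^+ j.+1 != 0 by rewrite expf_neq0// oppr_eq0 lt_eqF.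
  have zj : z ^+ j != 0 by rewrite expf_neq0// gt_eqF.
  have /negbT z1 := gt_eqF z0.
  rewrite le_eqVlt; apply/orP; left; apply/eqP; rewrite /C (exprS z).
  move: f0 u0 zj; move: (_`!%:R) ((- s) ^+ _) (z ^+ j) => f u zj f0 u0 zj0.
  by field; rewrite f0 u0 zj0 z1.
- exact: cvg_cst.
- rewrite -(mulr0 C); apply: cvgM; first exact: cvg_cst.
  by apply/gtr0_cvgV0 => //; exact: nbhs_pinfty_gt.
Unshelve. all: by end_near. Qed.

Lemma cvgr_exp_poly (p : {poly R}) (s : R) n (k t : 'I_n -> R) :
  s < 0 -> (forall i, t i < 0) ->
  exp_poly p s k t z @[z --> +oo] --> 0.
Proof.
move=> s0 t0.
have cvg_sum0 N (h : 'I_N -> R -> R) : (forall i, h i z @[z --> +oo] --> 0) ->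
    \sum_i h i z @[z --> +oo] --> 0.
  elim: N h => [h _|N IH h h0].
    by under eq_fun do rewrite big_ord0; exact: cvg_cst.
  under eq_fun do rewrite big_ord_recl.
  have := cvgD (h0 ord0) (IH (fun i => h (lift ord0 i)) (fun i => h0 (lift ord0 i))).
  rewrite addr0 => H; exact: H.
rewrite -[X in _ --> X]addr0; apply: cvgD.
  under eq_fun do rewrite horner_coef mulr_suml.
  apply: (cvg_sum0 _ (fun i z => p`_i * z ^+ i * expR (s * z))) => i.
  rewrite -[X in _ --> X](mulr0 p`_i).
  under eq_fun do rewrite -mulrA.
  by apply: cvgM; [exact: cvg_cst|exact: cvgr_expn_expRM].
apply: (cvg_sum0 _ (fun i z => k i * expR (t i * z))) => i.
rewrite -[X in _ --> X](mulr0 (k i)).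
by apply: cvgM; [exact: cvg_cst|exact: cvgr_expRM].
Qed.

Lemma is_derive_exp_poly_shift (p : {poly R}) (s : R) n (k t : 'I_n -> R) (x z : R) :
  is_derive z 1 (fun z => exp_poly p s k t (x + z))
    (exp_poly (p^`() + s *: p) s (fun i => k i * t i) t (x + z)).
Proof.
have h : is_derive z 1 (fun z => x + z) 1.
  rewrite -[X in is_derive _ _ _ X]add0r.
  exact: (@is_deriveD _ _ _ (cst x) id).
have := @is_derive1_comp _ _ (fun z => x + z) z _ _
  (is_derive_exp_poly p s k t (x + z)) h.
by rewrite mulr1.
Qed.

Lemma continuous_exp_poly_shift (p : {poly R}) (s : R) n (k t : 'I_n -> R) (x : R) :
  continuous (fun z => exp_poly p s k t (x + z)).
Proof.
move=> z; apply: differentiable_continuous; apply/derivable1_diffP.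
by have [] := is_derive_exp_poly_shift p s k t x z.
Qed.

Lemma integral_exp_poly (p : {poly R}) (s : R) n (k t : 'I_n -> R) (x a b : R) :
  a <= b ->
  (\int[lebesgue_measure]_(z in `[a, b[)
     (exp_poly (p^`() + s *: p) s (fun i => k i * t i) t (x + z))%:E =
   (exp_poly p s k t (x + b) - exp_poly p s k t (x + a))%:E)%E.
Proof.
(* The degenerate interval does occur: for [y = 0] the two interfaces of the value function
   coincide. *)
rewrite le_eqVlt => /predU1P[->|ab].
  by rewrite set_itv_ge ?bnd_simp ?ltxx// integral_set0 subrr.
rewrite integral_itv_bndo_bndc; last first.
  apply/measurable_EFinP; apply: measurable_funTS.
  by apply: continuous_measurable_fun; exact: continuous_exp_poly_shift.
have dE z := is_derive_exp_poly_shift p s k t x z.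
have cE := @continuous_exp_poly_shift p s n k t x.
rewrite (@continuous_FTC2 _ _ (fun z => exp_poly p s k t (x + z)))// ?EFinB//.
- by apply: continuous_subspaceT; exact: continuous_exp_poly_shift.
- split.
  + by move=> z _; have [] := dE z.
  + by apply: cvg_at_right_filter; exact: cE.
  + by apply: cvg_at_left_filter; exact: cE.
- by move=> z _; rewrite derive1E; have [_ ->] := dE z.
Qed.

(** All exponents are negative, so the primitive vanishes at infinity; the sign condition gives
    access to the fundamental theorem on a half-line. *)
Lemma integral_exp_polyy (p : {poly R}) (s : R) n (k t : 'I_n -> R) (x a : R) :
  s < 0 -> (forall i, t i < 0) ->
  (forall z, a <= z ->
    0 <= exp_poly (p^`() + s *: p) s (fun i => k i * t i) t (x + z)) ->
  (\int[lebesgue_measure]_(z in `[a, +oo[)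
     (exp_poly (p^`() + s *: p) s (fun i => k i * t i) t (x + z))%:E =
   (- exp_poly p s k t (x + a))%:E)%E.
Proof.
move=> s0 t0 f0.
have dE z := is_derive_exp_poly_shift p s k t x z.
have cE := @continuous_exp_poly_shift p s n k t x.
rewrite (@ge0_continuous_FTC2y _ _ (fun z => exp_poly p s k t (x + z)) _ 0) ?sub0e//.
- by apply: continuous_subspaceT; exact: continuous_exp_poly_shift.
- apply: (@cvg_comp _ _ _ _ _ _ (pinfty_nbhs R)); last exact: cvgr_exp_poly s0 t0.
  exact: cvg_addrl.
- by apply: cvg_at_right_filter; exact: cE.
- by move=> z _; rewrite derive1E; have [_ ->] := dE z.
Qed.

(* [exp (beta w)] times an antiderivative of
   [w |-> exp_poly p 0 k t w * beta * exp (- beta w)], for [p] of degree at most 2. *)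
Definition exp_prim (beta : R) (p : {poly R}) n (k t : 'I_n -> R) : R -> R :=
  exp_poly (- (p + beta^-1 *: p^`() + beta^-2 *: p^`()^`())) 0
    (fun i => k i * beta / (t i - beta)) t.

Section exp_weight.
Variables (beta : R) (p : {poly R}) (n : nat) (k t : 'I_n -> R) (x : R).
Hypotheses (beta0 : 0 < beta) (p3 : p^`()^`()^`() = 0)
  (tb : forall i, t i != beta).

(** Since [e^(- beta z) = e * e^(- beta (x + z))], absorbing [e] into the coefficients turns
    integrand and primitive into functions of [x + z]. *)
Let e := expR (beta * x).
Let P := e *: (- (p + beta^-1 *: p^`() + beta^-2 *: p^`()^`())).
Let k' i := e * (k i * beta / (t i - beta)).
Let t' i := t i - beta.

Let primE z : exp_poly P (- beta) k' t' (x + z) =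
  expR (- beta * z) * exp_prim beta p k t (x + z).
Proof.
have eE : expR (- beta * (x + z)) = expR (- beta * z) * e^-1.
  by rewrite /e -expRN -expRD; congr expR; ring.
have e0 : e != 0 by rewrite gt_eqF// expR_gt0.
rewrite /exp_prim /exp_poly eE mul0r expR0 mulr1 [in RHS]mulrDr /P hornerZ.
congr (_ + _).
  by field.
rewrite mulr_sumr; apply: eq_bigr => i _; rewrite /k' /t'.
have -> : expR ((t i - beta) * (x + z)) =
    expR (t i * (x + z)) * (expR (- beta * z) * e^-1).
  by rewrite -eE -expRD; congr expR; ring.
have := tb i; rewrite -subr_eq0 => ?; field.
by apply/andP.
Qed.

Let integrandE z :
  exp_poly (P^`() + (- beta) *: P) (- beta) (fun i => k' i * t' i) t' (x + z) =
  exp_poly p 0 k t (x + z) * (beta * expR (- beta * z)).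
Proof.
have eE : expR (- beta * (x + z)) = expR (- beta * z) * e^-1.
  by rewrite /e -expRN -expRD; congr expR; ring.
have e0 : e != 0 by rewrite gt_eqF// expR_gt0.
have b0 : beta != 0 by rewrite gt_eqF.
(* With [q = p + p' / beta + p'' / beta^2] one has [beta q - q' = beta p - p''' / beta^2], and the
   last term vanishes by [p3]. *)
have -> : P^`() + (- beta) *: P = (e * beta) *: p.
  have -> : P^`() = e *: - (p^`() + beta^-1 *: p^`()^`()).
    by rewrite /P derivZ derivN !derivD !derivZ p3 scaler0 addr0.
  by apply/polyP => i; rewrite /P !(coefD, coefZ, coefN); field.
rewrite /exp_poly eE mul0r expR0 mulr1 [in RHS]mulrDl hornerZ; congr (_ + _).
  by field.
rewrite mulr_suml; apply: eq_bigr => i _; rewrite /k' /t'.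
have -> : expR ((t i - beta) * (x + z)) =
    expR (t i * (x + z)) * (expR (- beta * z) * e^-1).
  by rewrite -eE -expRD; congr expR; ring.
have := tb i; rewrite -subr_eq0 => ?; field.
by apply/andP.
Qed.

Lemma integral_exp_weight a b : a <= b ->
  (\int[lebesgue_measure]_(z in `[a, b[)
     (exp_poly p 0 k t (x + z) * (beta * expR (- beta * z)))%:E =
   (expR (- beta * b) * exp_prim beta p k t (x + b)
    - expR (- beta * a) * exp_prim beta p k t (x + a))%:E)%E.
Proof.
move=> ab; under eq_integral do rewrite -integrandE.
by rewrite integral_exp_poly// !primE.
Qed.

Lemma integral_exp_weighty a : (forall i, t i < beta) ->
  (forall z, a <= z -> 0 <= exp_poly p 0 k t (x + z)) ->
  (\int[lebesgue_measure]_(z in `[a, +oo[)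
     (exp_poly p 0 k t (x + z) * (beta * expR (- beta * z)))%:E =
   (- (expR (- beta * a) * exp_prim beta p k t (x + a)))%:E)%E.
Proof.
move=> tlt f0; under eq_integral do rewrite -integrandE.
rewrite integral_exp_polyy ?primE ?oppr_lt0//.
- by move=> i; rewrite /t' subr_lt0.
- by move=> z az; rewrite integrandE !mulr_ge0 ?f0 ?expR_ge0// ltW.
Qed.

End exp_weight.

End exp_poly.
(** * Integration against the hyper-exponential law *)

Section density.
Context d (T : measurableType d) (R : realType).
Variables (P : {finite_measure set T -> \bar R})
          (mu : {sigma_finite_measure set T -> \bar R}) (p : T -> R).
Hypotheses (mp : measurable_fun setT p)
  (hP : forall B, measurable B -> P B = (\int[mu]_(x in B) (p x)%:E)%E).

(** [P] is absolutely continuous, and its Radon-Nikodym derivative agrees with [p] almost everywhere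
    because both have the same integral over every measurable set. *)
Lemma ge0_integral_density D (f : T -> \bar R) : measurable D ->
  measurable_fun D f -> (forall x, 0 <= f x)%E ->
  (\int[P]_(x in D) f x = \int[mu]_(x in D) (f x * (p x)%:E))%E.
Proof.
move=> mD mf f0.
have dom : P `<< mu.
  apply/null_content_dominatesP => A mA A0; rewrite hP//.
  by apply: null_set_integral => //; apply/measurable_EFinP; exact: measurable_funTS.
rewrite -(Radon_Nikodym_SigmaFinite.change_of_variables dom)//.
have iRN := Radon_Nikodym_SigmaFinite.f_integrable dom.
apply: ae_eq_integral => //.
- apply: emeasurable_funM => //; apply: measurable_funTS.
  exact: measurable_int iRN.
- apply: emeasurable_funM => //; apply/measurable_EFinP; exact: measurable_funTS.
apply: ae_eqe_mul2l; apply: integral_ae_eq => //.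
- exact: integrableS iRN.
- by apply/measurable_EFinP; exact: measurable_funTS.
- move=> E _ mE.
  by rewrite -Radon_Nikodym_SigmaFinite.f_integral// hP.
Qed.

End density.

Section hyperexp_integral.
Variables (R : realType) (m : nat) (omega beta : 'I_m -> R)
  (P : probability (measurableTypeR R) R).
Hypotheses (hb : hyperexp_params omega beta) (hP : hyperexp_law omega beta P).

Lemma ge0_integral_hyperexp (f : R -> R) :
  measurable_fun setT f -> (forall z, 0 <= f z) ->
  (\int[P]_(z in `]0%R, +oo[) (f z)%:E =
   \sum_i (omega i)%:E * \int[lebesgue_measure]_(z in `[0%R, +oo[)
     (f z * (beta i * expR (- beta i * z)))%:E)%E.
Proof.
move=> mf f0; have [_ b0 _ o0 _] := hb.
have mexp i : measurable_fun setT (fun z : R => beta i * expR (- beta i * z)).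
  by apply: measurable_funM => //; exact: measurable_expRM.
have mpdf : measurable_fun setT (hyperexp_pdf omega beta).
  apply/measurable_restrict => //; rewrite setTI; apply: measurable_funTS.
  apply: measurable_sum => i; apply: measurable_funM => //.
  exact: measurable_expRM.
rewrite (@ge0_integral_density _ (measurableTypeR R) R P lebesgue_measure _
  mpdf hP)//; last first.
  by apply/measurable_EFinP; exact: measurable_funTS.
transitivity (\int[lebesgue_measure]_(z in `]0%R, +oo[)
  \sum_i ((omega i)%:E * (f z * (beta i * expR (- beta i * z)))%:E))%E.
  apply: eq_integral => z z0; rewrite /hyperexp_pdf patchE z0 -EFinM mulr_sumr.
  by rewrite -sumEFin; apply: eq_bigr => i _; rewrite -EFinM; congr EFin; ring.
have fe0 i z : 0 <= f z * (beta i * expR (- beta i * z)).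
  by rewrite !mulr_ge0 ?expR_ge0 ?f0// ltW.
have mfe i : measurable_fun setT (fun z => f z * (beta i * expR (- beta i * z))).
  exact: measurable_funM.
rewrite ge0_integral_sum//; last 2 first.
- move=> i; apply: emeasurable_funM => //; apply/measurable_EFinP.
  by apply: measurable_funTS; exact: mfe.
- by move=> i z _; rewrite -EFinM lee_fin mulr_ge0// ltW.
apply: eq_bigr => i _; rewrite ge0_integralZl//; last 3 first.
- by apply/measurable_EFinP; apply: measurable_funTS; exact: mfe.
- by move=> z _; rewrite lee_fin.
- by rewrite lee_fin ltW.
(* The point [0] is a null set for Lebesgue measure, so the half-line may be closed. *)
rewrite integral_itv_obnd_cbnd//; apply/measurable_EFinP.
by apply: measurable_funTS; exact: mfe.
Qed.

End hyperexp_integral.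

(** * The three regions of the value function *)

Section vfun_pieces.
Variables (R : realType) (alpha c b : R) (m : nat) (K r : 'I_m.+1 -> R).
Hypotheses (alpha0 : 0 < alpha) (cb : c <= b) (K0 : forall j, 0 <= K j)
  (r0 : forall j, 0 < r j).
Local Notation v := (vfun alpha c b K r).

Definition low_coef (y : R) j : R :=
  K j / (alpha * r j) * (1 - expR (- alpha * r j * y)).

Definition low_fun y : R -> R :=
  exp_poly 0 0 (fun j => low_coef y j * expR (- (r j * b))) r.

Definition mid_poly : {poly R} :=
  (\sum_j K j / (alpha * r j))%:P
  + (2 * alpha)^-1 *: (('X - c%:P) ^+ 2 - ((b - c) ^+ 2)%:P).

Definition mid_fun y : R -> R :=
  exp_poly mid_poly 0
    (fun j => - (K j / (alpha * r j)) * expR (- (r j * (alpha * y + b)))) r.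

Definition high_poly y : {poly R} := y *: ('X - c%:P) - (alpha / 2 * y ^+ 2)%:P.

Definition high_fun y : R -> R :=
  exp_poly (high_poly y) 0 (fun=> 0) (fun _ : 'I_0 => 0).

Lemma low_coef_ge0 (y : R) j : 0 <= y -> 0 <= low_coef y j.
Proof.
move=> y0; rewrite mulr_ge0 ?divr_ge0 ?K0 ?mulr_ge0 ?(ltW alpha0) ?(ltW (r0 _))//.
rewrite subr_ge0 -expR0 ler_expR -mulrA mulNr oppr_le0.
by rewrite !mulr_ge0 ?(ltW alpha0) ?(ltW (r0 _)).
Qed.

Lemma vfunE (x y : R) : v x y =
  if x < b then low_fun y x else if x < alpha * y + b then mid_fun y x
  else high_fun y x.
Proof.
rewrite /vfun /low_fun /mid_fun /high_fun /exp_poly.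
case: ifP => _; last case: ifP => _.
- rewrite horner0 mul0r add0r; apply: eq_bigr => j _.
  by rewrite -/(low_coef y j) -mulrA -expRD; congr (_ * expR _); ring.
- rewrite mul0r expR0 mulr1 /mid_poly !hornerE.
  rewrite addrAC; congr (_ + _); last by rewrite mulrC.
  rewrite -big_split/=; apply: eq_bigr => j _.
  have -> : expR (- alpha * r j * (y - (x - b) / alpha)) =
      expR (- (r j * (alpha * y + b))) * expR (r j * x).
    rewrite -expRD; congr expR; have : alpha != 0 by rewrite gt_eqF.
    by move=> ?; field.
  by ring.
- by rewrite big_ord0 addr0 mul0r expR0 mulr1 /high_poly !hornerE; ring.
Qed.

(** Nonnegativity allows the integrals to be split and computed before integrability is known. *)
Lemma vfun_ge0 (x y : R) : 0 <= y -> 0 <= v x y.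
Proof.
move=> y0; rewrite /vfun; case: ltP => xb; last case: ltP => xy.
- apply: sumr_ge0 => j _; rewrite mulr_ge0 ?expR_ge0//.
  exact: low_coef_ge0.
- apply: addr_ge0.
    apply: sumr_ge0 => j _.
    rewrite mulr_ge0 ?divr_ge0 ?K0 ?mulr_ge0 ?(ltW alpha0) ?(ltW (r0 _))//.
    rewrite subr_ge0 -expR0 ler_expR -mulrA mulNr oppr_le0.
    rewrite !mulr_ge0 ?(ltW alpha0) ?(ltW (r0 _))//.
    by rewrite subr_ge0 ler_pdivrMr// mulrC lerBlDr ltW.
  rewrite divr_ge0 ?mulr_ge0 ?(ltW alpha0)// subr_ge0.
  by rewrite lerXn2r ?nnegrE ?subr_ge0 ?lerB// (le_trans cb).
- have ay0 : 0 <= alpha * y by rewrite mulr_ge0// ltW.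
  have h : 0 <= x - c - alpha / 2 * y by move: cb; lra.
  by have := mulr_ge0 h y0; rewrite expr2; lra.
Qed.

Lemma measurable_vfun (y : R) : measurable_fun setT (v ^~ y).
Proof.
under eq_fun do rewrite vfunE.
apply: measurable_fun_ifT; first exact: measurable_fun_ltr.
  exact: measurable_exp_poly.
apply: measurable_fun_ifT; first exact: measurable_fun_ltr.
  exact: measurable_exp_poly.
exact: measurable_exp_poly.
Qed.

Lemma measurableD_vfun (x y : R) : measurable_fun setT (fun z : R => v (x + z) y).
Proof.
apply: (measurableT_comp (measurable_vfun y)).
exact: measurable_funD.
Qed.

Lemma measurableB_vfun (x y : R) : measurable_fun setT (fun z : R => v (x - z) y).
Proof.
apply: (measurableT_comp (measurable_vfun y)).
exact: measurable_funB.
Qed.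

(** A downward jump from [x < b] stays below [b], so only the lower piece enters; in the jump size
    its exponentials have the negative rates [- r_j]. *)
Lemma integral_vfun_down (beta x y : R) : 0 < beta -> x < b -> 0 <= y ->
  (\int[lebesgue_measure]_(z in `[0%R, +oo[)
     (v (x - z) y * (beta * expR (- beta * z)))%:E =
   (\sum_j low_coef y j * expR (r j * (x - b)) * (beta / (beta + r j)))%:E)%E.
Proof.
move=> beta0 xb y0.
pose k j := low_coef y j * expR (r j * (x - b)).
have vE z : 0 <= z -> v (x - z) y = exp_poly 0 0 k (fun j => - r j) (0 + z).
  move=> z0; rewrite vfunE (le_lt_trans _ xb) ?gerBl//.
  rewrite /low_fun /exp_poly !horner0 !mul0r !add0r; apply: eq_bigr => j _.
  by rewrite /k -[LHS]mulrA -[RHS]mulrA -!expRD; congr (_ * expR _); ring.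
transitivity (\int[lebesgue_measure]_(z in `[0%R, +oo[)
    (exp_poly 0 0 k (fun j => - r j) (0 + z) * (beta * expR (- beta * z)))%:E)%E.
  by apply: eq_integral => z; rewrite inE/= in_itv/= andbT => /vE ->.
have rb j : - r j < beta by rewrite (lt_trans _ beta0)// oppr_lt0.
rewrite integral_exp_weighty//.
- rewrite !mulr0 expR0 mul1r /exp_prim /exp_poly !deriv0 !scaler0 !addr0 oppr0.
  rewrite horner0 mul0r add0r -sumrN; congr EFin; apply: eq_bigr => j _.
  rewrite mulr0 expR0 /k.
  have : beta + r j != 0 by rewrite gt_eqF// addr_gt0.
  have : - r j - beta != 0 by rewrite lt_eqF// subr_lt0.
  by move=> ? ?; field; apply/andP.
- by rewrite !deriv0.
- by move=> j; rewrite lt_eqF.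
- by move=> z z0; rewrite -vE// vfun_ge0.
Qed.

(** * Upward jumps across the interfaces *)

Section up.
Variables (beta : R).
Hypotheses (beta0 : 0 < beta) (rb : forall j, r j != beta)
  (sumK : \sum_j K j = b - c) (sumKr : \sum_j K j * r j = 1)
  (sumKbeta : \sum_j K j * r j ^+ 2 / (beta - r j) = 0).

(* Equality of the three primitives at the two interfaces, which is where the
   choice of [b] and [K] enters. *)
Lemma interface_identity :
  \sum_j K j / (alpha * r j) + (b - c) / (alpha * beta) + (alpha * beta ^+ 2)^-1
  + \sum_j K j / (alpha * r j) * (beta / (r j - beta)) = 0.
Proof.
(* Writing [b - c] as [sum_j K_j] and [1] as [sum_j K_j r_j] merges everything into one sum with
   terms [- K_j r_j^2 / (alpha beta^2 (beta - r_j))]. *)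
rewrite -sumK -[(alpha * beta ^+ 2)^-1]mul1r -sumKr !mulr_suml -!big_split/=.
transitivity (- (alpha * beta ^+ 2)^-1 * \sum_j K j * r j ^+ 2 / (beta - r j)).
  rewrite mulr_sumr; apply: eq_bigr => j _.
  have h1 : alpha != 0 by rewrite gt_eqF.
  have h2 : beta != 0 by rewrite gt_eqF.
  have h3 : r j != 0 by rewrite gt_eqF.
  have h4 := rb j; rewrite -subr_eq0 in h4.
  have h5 : beta - r j != 0 by rewrite -opprB oppr_eq0.
  by field; rewrite h1 h2 h3 h4 h5.
by rewrite sumKbeta mulr0.
Qed.

Let prim_low y := exp_prim beta 0 (fun j => low_coef y j * expR (- (r j * b))) r.
Let prim_mid y := exp_prim beta mid_poly
    (fun j => - (K j / (alpha * r j)) * expR (- (r j * (alpha * y + b)))) r.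
Let prim_high y := exp_prim beta (high_poly y) (fun=> 0) (fun _ : 'I_0 => 0).

Let mid_poly1 : mid_poly^`() = alpha^-1 *: ('X - c%:P).
Proof.
have h1 : alpha != 0 by rewrite gt_eqF.
rewrite /mid_poly derivD derivC add0r derivZ derivB derivC subr0.
rewrite expr2 derivM derivXsubC mul1r mulr1 scalerDr -scalerDl.
by congr (_ *: _); field.
Qed.

Let mid_poly2 : mid_poly^`()^`() = (alpha^-1)%:P.
Proof. by rewrite mid_poly1 derivZ derivXsubC alg_polyC. Qed.

Let high_poly1 y : (high_poly y)^`() = y%:P.
Proof. by rewrite /high_poly derivB derivC subr0 derivZ derivXsubC alg_polyC. Qed.

(** The exponentials are centred at [alpha * y + b], where they equal [1], and the difference of
    squares vanishes at [b]; this prepares [interface_identity] for both interfaces. *)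
Let prim_midE y x : prim_mid y x =
  - (\sum_j K j / (alpha * r j) + ((x - c) ^+ 2 - (b - c) ^+ 2) / (2 * alpha)
     + (x - c) / (alpha * beta) + (alpha * beta ^+ 2)^-1)
  - \sum_j K j / (alpha * r j) * (beta / (r j - beta))
      * expR (r j * (x - (alpha * y + b))).
Proof.
rewrite /prim_mid /exp_prim /exp_poly mul0r expR0 mulr1 mid_poly2 mid_poly1.
rewrite -sumrN; congr (_ + _); last first.
  apply: eq_bigr => j _.
  have -> : expR (r j * (x - (alpha * y + b))) =
      expR (- (r j * (alpha * y + b))) * expR (r j * x).
    by rewrite -expRD; congr expR; ring.
  by ring.
rewrite /mid_poly !(hornerD, hornerN, hornerZ, hornerC, hornerX, horner_exp).
have h1 : alpha != 0 by rewrite gt_eqF.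
have h2 : beta != 0 by rewrite gt_eqF.
by field; rewrite h1 h2.
Qed.

Let prim_low_mid y : prim_low y b = prim_mid y b.
Proof.
rewrite prim_midE subrr mul0r addr0.
have /eqP := interface_identity; rewrite addr_eq0 => /eqP ->.
rewrite opprK /prim_low /exp_prim /exp_poly !deriv0 !scaler0 !addr0 oppr0 horner0.
rewrite mul0r add0r -sumrB; apply: eq_bigr => j _.
have -> : expR (r j * (b - (alpha * y + b))) = expR (- alpha * r j * y).
  by congr expR; ring.
have /negbT e0 := expR_eq0 (r j * b).
have h1 : alpha != 0 by rewrite gt_eqF.
have h3 : r j != 0 by rewrite gt_eqF.
have h4 := rb j; rewrite -subr_eq0 in h4.
by rewrite /low_coef expRN; field; rewrite e0 h1 h3 h4.
Qed.

Let prim_mid_high y : prim_mid y (alpha * y + b) = prim_high y (alpha * y + b).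
Proof.
rewrite prim_midE subrr; under [X in _ - X]eq_bigr do rewrite mulr0 expR0 mulr1.
have /eqP := interface_identity; rewrite addrC addr_eq0 => /eqP ->.
rewrite /prim_high /exp_prim /exp_poly big_ord0 addr0 mul0r expR0 mulr1.
rewrite high_poly1 derivC /high_poly.
rewrite !(hornerD, hornerN, hornerZ, hornerC, hornerX, horner_exp).
have h1 : alpha != 0 by rewrite gt_eqF.
have h2 : beta != 0 by rewrite gt_eqF.
by field; rewrite h1 h2.
Qed.

(** The half-line is cut at the jump sizes that reach [b] and [alpha * y + b]. The boundary terms
    cancel there and only [- prim_low y x] remains. Exponentials occur on bounded intervals only, so
    rates [r_j > beta] cause no divergence. *)
Lemma integral_vfun_up (x y : R) : x < b -> 0 <= y ->
  (\int[lebesgue_measure]_(z in `[0%R, +oo[)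
     (v (x + z) y * (beta * expR (- beta * z)))%:E =
   (\sum_j low_coef y j * expR (r j * (x - b)) * (beta / (beta - r j)))%:E)%E.
Proof.
move=> xb y0.
pose d := b - x; pose d' := alpha * y + b - x.
pose g z := v (x + z) y * (beta * expR (- beta * z)).
have d0 : 0 <= d by rewrite subr_ge0 ltW.
have ay0 : 0 <= alpha * y by rewrite mulr_ge0// ltW.
have dd' : d <= d' by rewrite /d /d'; lra.
have g0 z : 0 <= g z by rewrite /g !mulr_ge0 ?vfun_ge0 ?expR_ge0// ltW.
have mg A : measurable_fun A (fun z => (g z)%:E).
  apply/measurable_EFinP; apply: measurable_funTS.
  apply: measurable_funM; first exact: measurableD_vfun.
  by apply: measurable_funM => //; exact: measurable_expRM.
have splity a a' : a <= a' ->
    (\int[lebesgue_measure]_(z in `[a, +oo[) (g z)%:E =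
     \int[lebesgue_measure]_(z in `[a, a'[) (g z)%:E
     + \int[lebesgue_measure]_(z in `[a', +oo[) (g z)%:E)%E.
  move=> aa'; rewrite -ge0_integral_setU//.
  - by rewrite -itv_bndbnd_setU// bnd_simp.
  - exact: mg.
  - by move=> z _; rewrite lee_fin.
  - rewrite disj_set2E; apply/eqP; rewrite -subset0 => z /= [].
    by rewrite !in_itv/= andbT => /andP[_ /lt_geF->].
rewrite -/g (splity 0 d)// (splity d d')//.
have -> : (\int[lebesgue_measure]_(z in `[0%R, d[) (g z)%:E =
  \int[lebesgue_measure]_(z in `[0%R, d[)
    (low_fun y (x + z) * (beta * expR (- beta * z)))%:E)%E.
  apply: eq_integral => z; rewrite inE/= in_itv/= => /andP[_ zd].
  by rewrite /g vfunE ifT// addrC -ltrBrDr.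
have -> : (\int[lebesgue_measure]_(z in `[d, d'[) (g z)%:E =
  \int[lebesgue_measure]_(z in `[d, d'[)
    (mid_fun y (x + z) * (beta * expR (- beta * z)))%:E)%E.
  apply: eq_integral => z; rewrite inE/= in_itv/= => /andP[dz zd'].
  rewrite /g vfunE ifF; last by apply/negbTE; rewrite -leNgt addrC -lerBlDr.
  by rewrite ifT// addrC -ltrBrDr.
have highE z : d' <= z -> v (x + z) y = high_fun y (x + z).
  move=> dz; have dz' := le_trans dd' dz.
  by rewrite vfunE !ifF//; apply/negbTE; rewrite -leNgt -lerBlDl.
have -> : (\int[lebesgue_measure]_(z in `[d', +oo[) (g z)%:E =
  \int[lebesgue_measure]_(z in `[d', +oo[)
    (high_fun y (x + z) * (beta * expR (- beta * z)))%:E)%E.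
  apply: eq_integral => z; rewrite inE/= in_itv/= andbT => dz.
  by rewrite /g highE.
rewrite integral_exp_weight ?deriv0// integral_exp_weight//; last first.
  by rewrite mid_poly2 derivC.
rewrite integral_exp_weighty//; last 3 first.
- by rewrite high_poly1 !derivC.
- by case.
- by move=> z dz; rewrite -[exp_poly _ _ _ _ _]highE// vfun_ge0.
rewrite -!/(prim_low y _) -!/(prim_mid y _) -!/(prim_high y _).
rewrite -!EFinD; congr EFin.
have -> : x + d = b by rewrite /d; ring.
have -> : x + d' = alpha * y + b by rewrite /d'; ring.
rewrite prim_low_mid prim_mid_high mulr0 expR0 mul1r addr0.
transitivity (- prim_low y x); first by ring.
rewrite /prim_low /exp_prim /exp_poly !deriv0 !scaler0 !addr0 oppr0 horner0.
rewrite mul0r add0r -sumrN; apply: eq_bigr => j _.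
have h4 := rb j; rewrite -subr_eq0 in h4.
have h5 : beta - r j != 0 by rewrite -opprB oppr_eq0.
have -> : expR (r j * (x - b)) = expR (- (r j * b)) * expR (r j * x).
  by rewrite -expRD; congr expR; ring.
by field; rewrite h4 h5.
Qed.

End up.
End vfun_pieces.

(** * Verification of the system *)

Lemma ge0_integrable_EFin d (T : measurableType d) (R : realType)
    (mu : {measure set T -> \bar R}) (D : set T) (f : T -> R) (l : R) :
  measurable D -> measurable_fun setT f -> (forall z, 0 <= f z) ->
  (\int[mu]_(z in D) (f z)%:E = l%:E)%E ->
  mu.-integrable D (fun z => (f z)%:E).
Proof.
move=> mD mf f0 fl; apply/integrableP; split.
  by apply/measurable_EFinP; exact: measurable_funTS.
under eq_integral do rewrite gee0_abs ?lee_fin//.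
by rewrite fl ltry.
Qed.

Theorem proposition4p1 (R : realType)
    (mu sigma alpha rho c lamn lamp : R)
    (hsigma : 0 < sigma) (halpha : 0 < alpha) (hrho : 0 < rho) (hc : 0 < c)
    (hlamn : 0 < lamn) (hlamp : 0 < lamp)
    (mn mp : nat)
    (omegan betan : 'I_mn -> R) (omegap betap : 'I_mp -> R)
    (hn : hyperexp_params omegan betan) (hp : hyperexp_params omegap betap)
    (Pn Pp : probability (measurableTypeR R) R)
    (hPn : hyperexp_law omegan betan Pn) (hPp : hyperexp_law omegap betap Pp)
    (r : 'I_mp.+1 -> R)
    (hroot : forall j : 'I_mp.+1,
       char_fun mu sigma rho lamn lamp omegan betan omegap betap (r j) = 0)
    (hinter : interlacing betap r) :
  let b := bstar c betap r in
  let K := constK betap r in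
  let v := vfun alpha c b K r in
  [/\ c < b,
      forall j : 'I_mp.+1, 0 < K j,
      forall x y : R, alpha * y + b <= x -> 0 <= y ->
        v x y = (x - c) * y - alpha * (y ^+ 2 / 2),
      forall x y : R, b <= x -> x < alpha * y + b -> 0 < y ->
        v x y = ((x - c) ^+ 2 - (c - b) ^+ 2) / (2 * alpha)
                + v b (y - (x - b) / alpha)
    & forall x y : R, x < b -> 0 <= y ->
        opD_defined Pn Pp v x y /\
        opD mu sigma rho lamn lamp Pn Pp v x y = 0].
Proof.
move=> b K v.
have K_gt0 j : 0 < K j by exact: constK_gt0.
have r_gt0 j : 0 < r j by exact: interlacing_root_gt0 hinter j.
have sumK : \sum_j K j = b - c by exact: sum_constK.
have cb : c < b.
  rewrite -subr_gt0 -sumK (bigD1 ord0)//= ltr_pwDl ?K_gt0//.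
  by apply: sumr_ge0 => j _; exact: ltW.
have cb' := ltW cb.
have K_ge0 j : 0 <= K j by exact: ltW.
have v0 x y : 0 <= y -> 0 <= v x y by exact: vfun_ge0.
split=> //.
- move=> x y xy y0; rewrite /v /vfun !ifF; first by ring.
    by apply/negbTE; rewrite -leNgt.
  apply/negbTE; rewrite -leNgt (le_trans _ xy)// lerDr mulr_ge0//; exact: ltW.
(* At first argument [b] the test [x < b] fails, so [v b _] is given by the middle branch once its
   second argument is shown positive. *)
- move=> x y bx xy y0; rewrite /v /vfun !ltxx ifF; last by apply/negbTE; rewrite -leNgt.
  rewrite xy ifT; last first.
    by rewrite ltrDr mulr_gt0// subr_gt0 ltr_pdivrMr// mulrC ltrBlDr.
  have -> : (c - b) ^+ 2 = (b - c) ^+ 2 by ring.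
  rewrite subrr mul0r subr0.
  by rewrite !subrr mul0r addr0 addrC.
move=> x y xb y0.
(* [D j] is the [j]-th exponential term of [v x y]; every term of the operator becomes a linear
   combination of the [D j]. *)
pose D j := low_coef alpha K r y j * expR (r j * (x - b)).
have [_ bn0 _ on0 _] := hn; have [_ bp0 _ op0 _] := hp.
have In : (\int[Pn]_(z in `]0%R, +oo[) (v (x - z) y)%:E =
    (\sum_i omegan i * \sum_j D j * (betan i / (betan i + r j)))%:E)%E.
  rewrite (ge0_integral_hyperexp hn hPn); last 2 first.
  - exact: measurableB_vfun.
  - by move=> z; exact: v0.
  rewrite -sumEFin; apply: eq_bigr => i _.
  by rewrite integral_vfun_down// -EFinM.
have Ip : (\int[Pp]_(z in `]0%R, +oo[) (v (x + z) y)%:E =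
    (\sum_i omegap i * \sum_j D j * (betap i / (betap i - r j)))%:E)%E.
  rewrite (ge0_integral_hyperexp hp hPp); last 2 first.
  - exact: measurableD_vfun.
  - by move=> z; exact: v0.
  rewrite -sumEFin; apply: eq_bigr => i _.
  rewrite integral_vfun_up//.
  - by move=> j; rewrite eq_sym; exact: interlacing_neq hinter i j.
  - exact: sum_constK_root.
  - exact: sum_constK_pole.
pose k j := low_coef alpha K r y j * expR (- (r j * b)).
have vE t : t < b -> v t y = exp_poly 0 0 k r t by move=> tb; rewrite /v vfunE// tb.
have poly0 : (0 : {poly R})^`() + 0 *: 0 = 0 by rewrite deriv0 scaler0 addr0.
(* [t < b] is an open condition, so both derivatives can be read off the lower exponential piece. *)
have near_b t : t < b -> \forall u \near t, u < b by exact: lt_nbhsl.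
have dv t : t < b -> is_derive t 1 (v ^~ y : R -> R)
    (exp_poly 0 0 (fun j => k j * r j) r t).
  move=> tb; have := is_derive_exp_poly 0 0 k r t; rewrite poly0.
  apply: near_eq_is_derive; near=> u; rewrite vE//.
  by near: u; exact: near_b.
have ddv : is_derive x 1 (derive1 (v ^~ y) : R -> R)
    (exp_poly 0 0 (fun j => k j * r j * r j) r x).
  have := is_derive_exp_poly 0 0 (fun j => k j * r j) r x; rewrite poly0.
  apply: near_eq_is_derive; near=> u; rewrite derive1E.
  have ub : u < b by near: u; exact: near_b.
  by have [_ ->] := dv _ ub.
have kE j : k j * expR (r j * x) = D j.
  by rewrite /k /D -mulrA -expRD; congr (_ * expR _); ring.
split.
  split.
  - near=> t.
    have tb : t < b by near: t; exact: near_b.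
    by have [] := dv _ tb.
  - by have [] := ddv.
  (* The finite values computed in [In] and [Ip] already give integrability, the integrands being
     nonnegative. *)
  - apply: ge0_integrable_EFin In => //; first exact: measurableB_vfun.
    by move=> z; exact: v0.
  - apply: ge0_integrable_EFin Ip => //; first exact: measurableD_vfun.
    by move=> z; exact: v0.
rewrite /opD /Rintegral In Ip /= derive1E.
have [_ ->] := ddv; rewrite derive1E; have [_ ->] := dv _ xb.
rewrite vE// /exp_poly !horner0 !mul0r !add0r.
(* Derivatives multiply [D j] by [r_j] and [r_j^2], jumps by the weighted [beta / (beta + r_j)] and
   [beta / (beta - r_j)]: the total factor is [char_fun] at [r j], zero by [hroot]. *)
transitivity (\sum_j D j *
    char_fun mu sigma rho lamn lamp omegan betan omegap betap (r j)); last first.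
  by apply: big1 => j _; rewrite hroot mulr0.
have swap n (w : 'I_n -> R) (q : 'I_n -> 'I_mp.+1 -> R) l :
    l * (\sum_i w i * \sum_j D j * q i j) = \sum_j D j * (l * \sum_i w i * q i j).
  rewrite mulr_sumr.
  under eq_bigr do rewrite !mulr_sumr.
  rewrite exchange_big/=; apply: eq_bigr => j _; rewrite !mulr_sumr.
  by apply: eq_bigr => i _; ring.
rewrite !swap !mulr_sumr -sumrN -!big_split/=; apply: eq_bigr => j _.
rewrite -!kE /char_fun.
under [X in lamn * X]eq_bigr do rewrite mulrA.
under [X in lamp * X]eq_bigr do rewrite mulrA.
by ring.
Unshelve. all: by end_near. Qed.
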